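(* Let $n$ be a positive integer. (1) For every integer $m>0$, $$\frac{(-1)^{m+1}}{4}\left(2\sum_{j=1}^{n-1}(-1)^jj^{2m}+(-1)^n n^{2m}\right)\frac{\pi^{2m+2}}{(2m)!}+(-1)^n\sum_{k=1}^m(-1)^k n^{2k-1}\frac{\pi^{2k}}{(2k-1)!}\,\lambda(2m-2k+2)=0.$$ (2) For every integer $m\geq0$, $$\frac{(-1)^{m+1}}{4}\left(2\sum_{j=1}^{n-1}(-1)^jj^{2m+1}+(-1)^n n^{2m+1}\right)\frac{\pi^{2m+2}}{(2m+1)!}+\sum_{k=0}^m(-1)^k\left((-1)^nn^{2k}-\delta_k\right)\frac{\pi^{2k}}{(2k)!}\,\lambda(2m-2k+2)=0,$$ where $\delta_k=0$ if $k\neq0$ and $\delta_k=1$ if $k=0$.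
   Context: The Dirichlet lambda function is $\lambda(s)=\sum_{n=0}^\infty\frac{1}{(2n+1)^s}$ for $\mathrm{Re}(s)>1$. An empty sum is taken to be zero. *)

(* Defs.v *)
From Stdlib Require Import Reals Arith Factorial.
From Coquelicot Require Import Coquelicot.
Open Scope R_scope.

(* The Dirichlet lambda function at a real argument; the series converges
   exactly for s > 1, and the value is meaningful only there. *)
Definition lambda (s : R) : R :=
  Series (fun n : nat => / Rpower (2 * INR n + 1) s).

Definition delta (k : nat) : R := if Nat.eqb k 0 then 1 else 0.

(* Main.v *)
Require Import Defs.
From Stdlib Require Import Reals Arith Factorial Lra Lia.
From Coquelicot Require Import Coquelicot.
Open Scope R_scope.

(** Write [L j = lambda (2 j + 2)] and let
      [E_m x = sum_(k <= m) (-1)^k (PI x)^(2k) / (2k)! L (m - k)],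
    with derivative [O_m] ([even_lambda_poly], [odd_lambda_poly]).  The two identities say that the alternating power
    sums [sum_j (-1)^j j^p], with their last term halved, equal
    [(-1)^n O_m n] (for [p = 2m]) or [(-1)^n E_m n - E_m 0] (for [p = 2m+1]) up
    to a constant factor.  Passing from [n] to [n + 1] in such a sum, the
    identities reduce to a functional equation
      [Q (x + 1) + Q x = c ((x + 1)^p - x^p)],
    where [Q] is [O_m] or [E_m] ([lambda_poly_shift]).

    The functional equations form a single chain under differentiation, because
    [E_m' = O_m] and [O_(m+1)' = - PI^2 E_m]; so each follows from the preceding
    one once it is known at a single point.  At [x = -1/2], where [x] and
    [x + 1] are opposite, both sides vanish for [O_m] by parity, while for
    [E_m], which is even, the equation prescribes the value [E_m (1/2)].

    That value ([lambda_recurrence]) is the only analytic input.  Integrate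
    [f t = (PI/2 - t)^(2m+1) / (2m+1)!] against
    [D_N t = sum_(r <= N) cos ((2r+1) t)] from [0] to [PI/2].  Integration by
    parts, term by term, gives partial sums of the series for [L 0, ..., L m],
    with the coefficients of [E_m (1/2)] up to sign
    ([is_RInt_half_PI_sub_pow_odd_cos]).  On the other hand
    [2 sin t D_N t = sin (2 (N+1) t)], so the integral tends to
    [PI/4 * f 0]: for constant [f] this is Leibniz's series for [PI/4], and the
    rest is a Riemann-Lebesgue argument ([lim_RInt_mult_odd_cos_sum]). *)

(** Rewriting with the algebraic hierarchy leaves equations at a carrier that is
    only convertible to [R], which [ring] and [field] do not accept. *)
Ltac real_eq := match goal with |- ?x = ?y => change (@eq R x y) end.

(** * The kernel of odd cosines *)

Definition odd_cos_sum (N : nat) (t : R) : R :=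
  sum_n (fun r : nat => cos ((2 * INR r + 1) * t)) N.

Lemma sin_mul_odd_cos_sum (N : nat) (t : R) :
  2 * sin t * odd_cos_sum N t = sin (2 * INR (S N) * t).
Proof.
  unfold odd_cos_sum; induction N as [|N IH].
  - rewrite sum_O. simpl INR.
    replace ((2 * 0 + 1) * t) with t by ring.
    replace (2 * 1 * t) with (2 * t) by ring.
    rewrite sin_2a; ring.
  - rewrite sum_Sn. change plus with Rplus. rewrite Rmult_plus_distr_l, IH.
    replace (2 * INR (S N) * t) with ((2 * INR (S N) + 1) * t - t) by ring.
    rewrite (S_INR (S N)).
    replace (2 * (INR (S N) + 1) * t) with ((2 * INR (S N) + 1) * t + t) by ring.
    rewrite sin_minus, sin_plus; ring.
Qed.

Lemma continuous_odd_cos_sum (N : nat) (t : R) : continuous (odd_cos_sum N) t.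
Proof.
  apply (@ex_derive_continuous R_AbsRing R_NormedModule).
  exists (sum_n (fun r => - (2 * INR r + 1) * sin ((2 * INR r + 1) * t)) N).
  apply (is_derive_sum_n (fun r t => cos ((2 * INR r + 1) * t))).
  intros k _. auto_derive; trivial. ring.
Qed.

Lemma sin_odd_half_PI (r : nat) : sin ((2 * INR r + 1) * (PI / 2)) = (-1) ^ r.
Proof.
  induction r as [|r IH].
  - simpl. replace ((2 * 0 + 1) * (PI / 2)) with (PI / 2) by ring. apply sin_PI2.
  - rewrite S_INR.
    replace ((2 * (INR r + 1) + 1) * (PI / 2)) with ((2 * INR r + 1) * (PI / 2) + PI) by field.
    rewrite neg_sin, IH; simpl; ring.
Qed.

Lemma cos_odd_half_PI (r : nat) : cos ((2 * INR r + 1) * (PI / 2)) = 0.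
Proof.
  induction r as [|r IH].
  - simpl. replace ((2 * 0 + 1) * (PI / 2)) with (PI / 2) by ring. apply cos_PI2.
  - rewrite S_INR.
    replace ((2 * (INR r + 1) + 1) * (PI / 2)) with ((2 * INR r + 1) * (PI / 2) + PI) by field.
    rewrite neg_cos, IH; ring.
Qed.

Lemma is_RInt_sum_n (f : nat -> R -> R) (v : nat -> R) (a b : R) (N : nat) :
  (forall r : nat, is_RInt (f r) a b (v r)) ->
  is_RInt (fun t => sum_n (fun r => f r t) N) a b (sum_n v N).
Proof.
  intros H; induction N as [|N IH].
  - rewrite sum_O. apply (is_RInt_ext (f 0%nat)); [|apply H].
    intros; rewrite sum_O; reflexivity.
  - rewrite sum_Sn.
    apply (is_RInt_ext (fun t => plus (sum_n (fun r => f r t) N) (f (S N) t))).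
    { intros; rewrite sum_Sn; reflexivity. }
    apply (@is_RInt_plus R_NormedModule); [apply IH|apply H].
Qed.

Lemma odd_pos (r : nat) : 0 < 2 * INR r + 1.
Proof. pose proof (pos_INR r); lra. Qed.

(** The integral of [cos ((2r+1) t)] over a quarter period is
    [(-1)^r / (2r+1)], so this is Leibniz's series. *)
Lemma lim_RInt_odd_cos_sum :
  is_lim_seq (fun N => RInt (odd_cos_sum N) 0 (PI / 2)) (PI / 4).
Proof.
  apply is_lim_seq_ext with (sum_f_R0 (tg_alt PI_tg)).
  - intros N; symmetry; rewrite <- sum_n_Reals. apply is_RInt_unique.
    apply is_RInt_sum_n. intros r. pose proof (odd_pos r) as Hr.
    replace (tg_alt PI_tg r)
      with (minus (sin ((2 * INR r + 1) * (PI / 2)) / (2 * INR r + 1))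
                  (sin ((2 * INR r + 1) * 0) / (2 * INR r + 1))).
    + apply (is_RInt_derive (fun t => sin ((2 * INR r + 1) * t) / (2 * INR r + 1))).
      * intros x _. auto_derive; trivial. field; lra.
      * intros x _. apply (@ex_derive_continuous R_AbsRing R_NormedModule).
        auto_derive; trivial.
    + rewrite sin_odd_half_PI, Rmult_0_r, sin_0. unfold tg_alt, PI_tg, minus, plus, opp; simpl.
      replace (INR (r + (r + 0) + 1)) with (2 * INR r + 1)
        by (rewrite !plus_INR; simpl; ring).
      field; lra.
  - replace (PI / 4) with (let (a, _) := exist_PI in a).
    + destruct exist_PI as [a Ha]. apply is_lim_seq_Reals, Ha.
    + rewrite <- Alt_PI_eq; unfold Alt_PI; field.
Qed.

(** * A Riemann-Lebesgue lemma for the kernel *)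

Lemma continuous_bounded_segment (f : R -> R) (a b : R) :
  (forall x, a <= x <= b -> continuous f x) ->
  exists M, 0 <= M /\ forall x, a <= x <= b -> Rabs (f x) <= M.
Proof.
  intros H. destruct (bounded_continuity f a b H) as [M HM].
  exists (Rmax M 0); split; [apply Rmax_r|].
  intros x Hx. apply Rle_trans with M; [|apply Rmax_l].
  left; apply (HM x Hx).
Qed.

(** One integration by parts gains a factor [/ omega] and leaves boundary
    terms and an integral that are bounded uniformly in [omega]. *)
Lemma RInt_sin_bound (g g' : R -> R) (a b : R) :
  a <= b ->
  (forall t, a <= t <= b -> is_derive g t (g' t)) ->
  (forall t, a <= t <= b -> continuous g' t) ->
  exists M, 0 <= M /\ forall omega, 0 < omega ->
    Rabs (RInt (fun t => g t * sin (omega * t)) a b) <= M / omega.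
Proof.
  intros Hab Hg Hg'.
  assert (Cg : forall t, a <= t <= b -> continuous g t).
  { intros t Ht. apply (@ex_derive_continuous R_AbsRing R_NormedModule).
    exists (g' t); auto. }
  destruct (continuous_bounded_segment g a b Cg) as [B [HB Bg]].
  destruct (continuous_bounded_segment g' a b Hg') as [D [HD Dg]].
  exists (2 * B + (b - a) * D); split.
  { assert (0 <= (b - a) * D) by (apply Rmult_le_pos; lra). lra. }
  intros w Hw.
  assert (Csin : forall t, continuous (fun t => sin (w * t)) t).
  { intros t; apply (@ex_derive_continuous R_AbsRing R_NormedModule); auto_derive; trivial. }
  assert (Ccos : forall t, continuous (fun t => cos (w * t)) t).
  { intros t; apply (@ex_derive_continuous R_AbsRing R_NormedModule); auto_derive; trivial. }
  set (h := fun t => g t * sin (w * t)).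
  set (k := fun t => g' t * cos (w * t)).
  assert (Ch : forall t, a <= t <= b -> continuous h t).
  { intros t Ht; apply (continuous_mult g (fun t => sin (w * t))); auto. }
  assert (Ck : forall t, a <= t <= b -> continuous k t).
  { intros t Ht; apply (continuous_mult g' (fun t => cos (w * t))); auto. }
  assert (Ih : ex_RInt h a b).
  { apply (@ex_RInt_continuous R_CompleteNormedModule).
    intros t; rewrite Rmin_left, Rmax_right by lra; auto. }
  assert (Ik : ex_RInt k a b).
  { apply (@ex_RInt_continuous R_CompleteNormedModule).
    intros t; rewrite Rmin_left, Rmax_right by lra; auto. }
  assert (E : RInt h a b = (RInt k a b - (g b * cos (w * b) - g a * cos (w * a))) / w).
  { assert (P : is_RInt (fun t => minus (k t) (scal w (h t))) a b
                  (minus (g b * cos (w * b)) (g a * cos (w * a)))).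
    { apply (is_RInt_derive (fun t => g t * cos (w * t))).
      - intros t; rewrite Rmin_left, Rmax_right by lra; intros Ht.
        unfold minus, plus, opp, scal, k, h; simpl. unfold mult; simpl.
        auto_derive.
        + exists (g' t); auto.
        + change (Derive (fun x : R => g x) t) with (Derive g t).
          rewrite (is_derive_unique g t (g' t) (Hg t Ht)). ring.
      - intros t; rewrite Rmin_left, Rmax_right by lra; intros Ht.
        apply (continuous_minus k (fun t => scal w (h t))); auto.
        apply (@continuous_scal_r R_UniformSpace R_AbsRing R_NormedModule); auto. }
    assert (Q : is_RInt (fun t => minus (k t) (scal w (h t))) a b
                  (minus (RInt k a b) (scal w (RInt h a b)))).
    { apply (@is_RInt_minus R_NormedModule); [apply (RInt_correct k); auto|].
      apply (@is_RInt_scal R_NormedModule); apply (RInt_correct h); auto. }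
    apply (@is_RInt_unique R_CompleteNormedModule) in P.
    apply (@is_RInt_unique R_CompleteNormedModule) in Q. rewrite P in Q.
    unfold minus, plus, opp, scal in Q; simpl in Q. unfold mult in Q; simpl in Q.
    apply (Rmult_eq_reg_l w); [|lra]. field_simplify; lra. }
  rewrite E. unfold Rdiv at 1. rewrite Rabs_mult, (Rabs_pos_eq (/ w)) by (left; apply Rinv_0_lt_compat; lra).
  apply Rmult_le_compat_r; [left; apply Rinv_0_lt_compat; lra|].
  assert (K : Rabs (RInt k a b) <= (b - a) * D).
  { apply (abs_RInt_le_const k a b D Hab Ik). intros t Ht. unfold k.
    rewrite Rabs_mult. specialize (Dg t Ht).
    assert (Rabs (cos (w * t)) <= 1) by (apply Rabs_le, COS_bound).
    pose proof (Rabs_pos (g' t)). nra. }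
  assert (U : forall t, a <= t <= b -> Rabs (g t * cos (w * t)) <= B).
  { intros t Ht. rewrite Rabs_mult. specialize (Bg t Ht).
    assert (Rabs (cos (w * t)) <= 1) by (apply Rabs_le, COS_bound).
    pose proof (Rabs_pos (g t)). nra. }
  pose proof (U a ltac:(lra)) as Ua. pose proof (U b ltac:(lra)) as Ub.
  apply Rabs_le_between in K; apply Rabs_le_between in Ua; apply Rabs_le_between in Ub.
  apply Rabs_le; lra.
Qed.

(** Between [0] and [1] the cosine stays above [cos (PI/3) = 1/2]. *)
Lemma sin_ge_half (t : R) : 0 <= t <= 1 -> t / 2 <= sin t.
Proof.
  intros Ht.
  assert (HPI : 3 < PI) by (pose proof PI2_3_2; lra).
  destruct (Req_dec t 0) as [->|Ht0]; [rewrite sin_0; lra|].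
  destruct (MVT_cor2 (fun t => sin t - t / 2) (fun t => cos t - 1 / 2) 0 t) as [c [E Hc]].
  { lra. }
  { intros c _. apply is_derive_Reals. auto_derive; trivial. field. }
  assert (1 / 2 <= cos c).
  { rewrite <- cos_PI3. apply cos_decr_1; lra. }
  rewrite sin_0 in E. nra.
Qed.

(** The kernel is [sin (2 (N+1) t) / (2 sin t)].  Near [0] the zero of [w]
    compensates that of [sin], so the integrand is bounded there independently
    of [N] and a short interval contributes little; away from [0],
    [w / (2 sin)] is continuously differentiable and [RInt_sin_bound]
    applies. *)
Lemma riemann_lebesgue_odd_cos_sum (w w' : R -> R) :
  (forall t, is_derive w t (w' t)) ->
  (forall t, continuous w' t) ->
  w 0 = 0 ->
  is_lim_seq (fun N => RInt (fun t => w t * odd_cos_sum N t) 0 (PI / 2)) 0.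
Proof.
  intros Hw Hw' w0. pose proof PI2_1 as HPI.
  assert (Cw : forall t, continuous w t).
  { intros t. apply (@ex_derive_continuous R_AbsRing R_NormedModule).
    exists (w' t); auto. }
  destruct (continuous_bounded_segment w' 0 (PI / 2)) as [C [HC Bw']]; [auto|].
  assert (Lip : forall t, 0 <= t <= PI / 2 -> Rabs (w t) <= C * t).
  { intros t Ht.
    destruct (MVT_abs w w' 0 t) as [c [E Hc]].
    { intros c _; apply is_derive_Reals, Hw. }
    rewrite Rmin_left, Rmax_right in Hc by lra.
    rewrite w0, !Rminus_0_r, (Rabs_pos_eq t) in E by lra.
    rewrite E. apply Rmult_le_compat_r; [lra|]. apply Bw'; lra. }
  apply is_lim_seq_spec. intros eps; simpl.
  pose proof (cond_pos eps) as He.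
  (* [C] bounds the integrand near 0: the piece from 0 to [d] costs at most [d * C]. *)
  set (d := Rmin 1 (eps / (2 * (C + 1)))).
  assert (Hd0 : 0 < d).
  { apply Rmin_glb_lt; [lra|]. apply Rdiv_lt_0_compat; lra. }
  assert (Hd1 : d <= 1) by apply Rmin_l.
  assert (HdC : d * C < eps / 2).
  { assert (d <= eps / (2 * (C + 1))) by apply Rmin_r.
    assert (eps / (2 * (C + 1)) * (C + 1) = eps / 2) by (field; lra). nra. }
  destruct (RInt_sin_bound (fun t => w t / (2 * sin t))
     (fun t => (w' t * sin t - w t * cos t) / (2 * (sin t * sin t))) d (PI / 2)) as [M [HM BM]].
  { lra. }
  { intros t Ht. assert (sin t <> 0) by (apply Rgt_not_eq, sin_gt_0; lra).
    auto_derive.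
    - split; [exists (w' t); auto|]. split; [lra|trivial].
    - change (Derive (fun x : R => w x) t) with (Derive w t).
      rewrite (is_derive_unique w t (w' t) (Hw t)). field; auto. }
  { intros t Ht. assert (sin t <> 0) by (apply Rgt_not_eq, sin_gt_0; lra).
    apply (continuous_mult (fun t => w' t * sin t - w t * cos t)
             (fun t => / (2 * (sin t * sin t)))).
    - apply (continuous_minus (fun t => w' t * sin t) (fun t => w t * cos t)).
      + apply (continuous_mult w' sin); auto. apply continuous_sin.
      + apply (continuous_mult w cos); auto. apply continuous_cos.
    - apply (@ex_derive_continuous R_AbsRing R_NormedModule). auto_derive.
      repeat split; trivial. intros E. nra. }
  (* For [N >= N0], the frequency [2 (N + 1)] exceeds [2 M / eps], so the piece
     from [d] to [PI / 2] costs at most [eps / 2]. *)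
  destruct (nfloor_ex (M / eps)) as [N0 HN0].
  { apply Rdiv_le_0_compat; lra. }
  exists N0. intros N HN. rewrite Rminus_0_r.
  assert (CwK : forall t, continuous (fun t => w t * odd_cos_sum N t) t).
  { intros t. apply (continuous_mult w (odd_cos_sum N)); auto.
    apply continuous_odd_cos_sum. }
  assert (Ex : forall a b, ex_RInt (fun t => w t * odd_cos_sum N t) a b).
  { intros a b; apply (@ex_RInt_continuous R_CompleteNormedModule); auto. }
  rewrite <- (RInt_Chasles (fun t => w t * odd_cos_sum N t) 0 d (PI / 2)) by auto.
  change plus with Rplus.
  assert (B1 : Rabs (RInt (fun t => w t * odd_cos_sum N t) 0 d) <= (d - 0) * C).
  { apply abs_RInt_le_const; [lra|auto|]. intros t Ht.
    destruct (Req_dec t 0) as [->|Ht0].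
    { rewrite w0, Rmult_0_l, Rabs_R0; auto. }
    pose proof (sin_ge_half t ltac:(lra)) as Hs.
    apply Rmult_le_reg_l with (2 * sin t); [lra|].
    rewrite <- (Rabs_pos_eq (2 * sin t)) at 1 by lra.
    rewrite <- Rabs_mult.
    replace (2 * sin t * (w t * odd_cos_sum N t))
      with (w t * (2 * sin t * odd_cos_sum N t)) by ring.
    rewrite sin_mul_odd_cos_sum, Rabs_mult.
    assert (Rabs (sin (2 * INR (S N) * t)) <= 1) by (apply Rabs_le, SIN_bound).
    pose proof (Lip t ltac:(lra)). pose proof (Rabs_pos (w t)). nra. }
  assert (B2 : Rabs (RInt (fun t => w t * odd_cos_sum N t) d (PI / 2)) <= eps / 2).
  { rewrite (RInt_ext _ (fun t => w t / (2 * sin t) * sin (2 * INR (S N) * t))).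
    - assert (HS : 0 < INR (S N)) by (apply lt_0_INR; lia).
      eapply Rle_trans; [apply BM; lra|].
      assert (INR N0 <= INR N) by (apply le_INR; auto).
      rewrite S_INR in *.
      apply Rle_div_l; [lra|].
      assert (M < eps * (INR N0 + 1)).
      { destruct HN0 as [_ HN0]. apply Rlt_div_l in HN0; [|lra]. lra. }
      nra.
    - intros t; rewrite Rmin_left, Rmax_right by lra; intros Ht.
      assert (0 < sin t) by (apply sin_gt_0; lra).
      rewrite <- sin_mul_odd_cos_sum. real_eq. field; lra. }
  eapply Rle_lt_trans; [apply Rabs_triang|]. lra.
Qed.

(** Split [f] as [(f - f 0) + f 0]. *)
Lemma lim_RInt_mult_odd_cos_sum (f f' : R -> R) :
  (forall t, is_derive f t (f' t)) ->
  (forall t, continuous f' t) ->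
  is_lim_seq (fun N => RInt (fun t => f t * odd_cos_sum N t) 0 (PI / 2)) (PI / 4 * f 0).
Proof.
  intros Hf Hf'.
  assert (Cf : forall t, continuous f t).
  { intros t. apply (@ex_derive_continuous R_AbsRing R_NormedModule).
    exists (f' t); auto. }
  assert (Cw : forall t, continuous (fun t => f t - f 0) t).
  { intros t. apply (continuous_minus f (fun _ => f 0)); [auto|apply continuous_const]. }
  apply is_lim_seq_ext with (fun N =>
    RInt (fun t => (f t - f 0) * odd_cos_sum N t) 0 (PI / 2)
    + f 0 * RInt (odd_cos_sum N) 0 (PI / 2)).
  { intros N.
    assert (E1 : ex_RInt (fun t => (f t - f 0) * odd_cos_sum N t) 0 (PI / 2)).
    { apply (@ex_RInt_continuous R_CompleteNormedModule). intros t _.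
      apply (continuous_mult (fun t => f t - f 0) (odd_cos_sum N)); auto.
      apply continuous_odd_cos_sum. }
    assert (E2 : ex_RInt (odd_cos_sum N) 0 (PI / 2)).
    { apply (@ex_RInt_continuous R_CompleteNormedModule). intros t _.
      apply continuous_odd_cos_sum. }
    symmetry. apply is_RInt_unique.
    apply (is_RInt_ext (fun t => plus ((f t - f 0) * odd_cos_sum N t)
                                      (scal (f 0) (odd_cos_sum N t)))).
    { intros t _. unfold plus, scal; simpl; unfold mult; simpl. ring. }
    apply (@is_RInt_plus R_NormedModule); [apply (RInt_correct (fun t => (f t - f 0) * odd_cos_sum N t)); auto|].
    apply (@is_RInt_scal R_NormedModule). apply (RInt_correct (odd_cos_sum N)); auto. }
  replace (PI / 4 * f 0) with (0 + f 0 * (PI / 4)) by ring.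
  apply is_lim_seq_plus'.
  - apply (riemann_lebesgue_odd_cos_sum (fun t => f t - f 0) f'); auto; [|ring].
    intros t. evar_last; [apply (is_derive_minus f (fun _ => f 0) t (f' t) 0); auto|].
    + apply (@is_derive_const R_AbsRing R_NormedModule).
    + unfold minus, plus, opp; simpl; ring.
  - apply (is_lim_seq_scal_l _ (f 0) (PI / 4)), lim_RInt_odd_cos_sum.
Qed.

(** * Moments of the kernel and values of lambda *)

(** The normalisation by [p!] makes differentiation send [half_PI_sub_pow (S p)] to
    [- half_PI_sub_pow p]; all of these vanish at [PI/2] except the constant one. *)
Definition half_PI_sub_pow (p : nat) (t : R) : R := (PI / 2 - t) ^ p / INR (fact p).

Lemma is_derive_pow_fact (p : nat) (x : R) :
  is_derive (fun x => x ^ S p / INR (fact (S p))) x (x ^ p / INR (fact p)).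
Proof.
  rewrite fact_simpl, mult_INR.
  pose proof (INR_fact_neq_0 p). pose proof (not_0_INR (S p) ltac:(lia)).
  assert (G : forall q c, is_derive (fun x => x ^ q / c) x (INR q * x ^ pred q / c)).
  { intros q c. auto_derive; trivial. unfold Rdiv; ring. }
  evar_last; [apply G|]. simpl pred. field; auto.
Qed.

Lemma is_derive_half_PI_sub_pow (p : nat) (t : R) :
  is_derive (half_PI_sub_pow (S p)) t (- half_PI_sub_pow p t).
Proof.
  unfold half_PI_sub_pow.
  evar_last.
  - apply (is_derive_comp (fun x => x ^ S p / INR (fact (S p))) (fun t => PI / 2 - t)).
    + apply is_derive_pow_fact.
    + auto_derive; trivial.
  - unfold scal; simpl; unfold mult; simpl. ring.
Qed.

Lemma continuous_half_PI_sub_pow (p : nat) (t : R) : continuous (half_PI_sub_pow p) t.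
Proof.
  apply (@ex_derive_continuous R_AbsRing R_NormedModule).
  unfold half_PI_sub_pow; auto_derive; trivial.
Qed.

Lemma is_RInt_half_PI_sub_pow_1_cos (a : R) :
  a <> 0 -> cos (a * (PI / 2)) = 0 ->
  is_RInt (fun t => half_PI_sub_pow 1 t * cos (a * t)) 0 (PI / 2) (/ a ^ 2).
Proof.
  intros Ha Hc.
  evar_last.
  - apply (is_RInt_derive
      (fun t => half_PI_sub_pow 1 t * sin (a * t) / a - cos (a * t) / a ^ 2)).
    + intros t _. unfold half_PI_sub_pow. auto_derive; trivial. simpl. field; auto.
    + intros t _. apply (@ex_derive_continuous R_AbsRing R_NormedModule).
      unfold half_PI_sub_pow; auto_derive; trivial.
  - unfold minus, plus, opp, half_PI_sub_pow; simpl. rewrite Hc, Rmult_0_r, sin_0, cos_0.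
    field; auto.
Qed.

(** Two integrations by parts.  The boundary terms at [PI/2] vanish with
    [half_PI_sub_pow], and of those at [0] only the one with the cosine remains. *)
Lemma is_RInt_half_PI_sub_pow_cos_step (p : nat) (a I : R) :
  a <> 0 ->
  is_RInt (fun t => half_PI_sub_pow (S p) t * cos (a * t)) 0 (PI / 2) I ->
  is_RInt (fun t => half_PI_sub_pow (S (S (S p))) t * cos (a * t)) 0 (PI / 2)
    (/ a ^ 2 * (half_PI_sub_pow (S (S p)) 0 - I)).
Proof.
  intros Ha HI.
  (* [F] is a primitive of [f], whose second summand is a multiple of the
     integrand of [I]. *)
  set (F := fun t => half_PI_sub_pow (S (S (S p))) t * sin (a * t) / a
                     - half_PI_sub_pow (S (S p)) t * cos (a * t) / a ^ 2).
  set (f := fun t => half_PI_sub_pow (S (S (S p))) t * cos (a * t)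
                     + half_PI_sub_pow (S p) t * cos (a * t) / a ^ 2).
  assert (HF : is_RInt f 0 (PI / 2) (minus (F (PI / 2)) (F 0))).
  { apply (is_RInt_derive F).
    - intros t _. unfold F, f.
      auto_derive.
      + repeat split; trivial; eexists; apply is_derive_half_PI_sub_pow.
      + change (Derive (fun x : R => half_PI_sub_pow (S (S (S p))) x) t)
          with (Derive (half_PI_sub_pow (S (S (S p)))) t).
        change (Derive (fun x : R => half_PI_sub_pow (S (S p)) x) t)
          with (Derive (half_PI_sub_pow (S (S p))) t).
        rewrite !(is_derive_unique _ _ _ (is_derive_half_PI_sub_pow _ t)).
        field; auto.
    - intros t _. apply (@ex_derive_continuous R_AbsRing R_NormedModule).
      unfold f; auto_derive.
      repeat split; trivial; eexists; apply is_derive_half_PI_sub_pow. }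
  apply (is_RInt_ext (fun t => minus (f t) (scal (/ a ^ 2) (half_PI_sub_pow (S p) t * cos (a * t))))).
  { intros t _. unfold f, minus, plus, opp, scal; simpl; unfold mult; simpl.
    real_eq. field; auto. }
  evar_last.
  - apply (@is_RInt_minus R_NormedModule); [apply HF|].
    apply (@is_RInt_scal R_NormedModule); apply HI.
  - assert (Z : forall q, half_PI_sub_pow (S q) (PI / 2) = 0).
    { intros q; unfold half_PI_sub_pow. rewrite Rminus_diag, pow_ne_zero by lia. unfold Rdiv; ring. }
    unfold F, minus, plus, opp, scal; cbn -[half_PI_sub_pow pow]; unfold mult; cbn -[half_PI_sub_pow pow].
    rewrite !Z, Rmult_0_r, sin_0, cos_0. field; auto.
Qed.

Lemma is_RInt_half_PI_sub_pow_odd_cos (m : nat) (a : R) :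
  a <> 0 -> cos (a * (PI / 2)) = 0 ->
  is_RInt (fun t => half_PI_sub_pow (2 * m + 1) t * cos (a * t)) 0 (PI / 2)
    (sum_n (fun k => (-1) ^ m * (-1) ^ k * ((PI / 2) ^ (2 * k) / INR (fact (2 * k)))
                     * / a ^ (2 * (m - k) + 2)) m).
Proof.
  intros Ha Hc; induction m as [|m IH].
  - rewrite sum_O. evar_last; [apply (is_RInt_half_PI_sub_pow_1_cos a Ha Hc)|].
    simpl. field; auto.
  - replace (2 * m + 1)%nat with (S (2 * m)) in IH by lia.
    apply is_RInt_half_PI_sub_pow_cos_step in IH; auto.
    replace (2 * S m + 1)%nat with (S (S (S (2 * m)))) by lia.
    evar_last; [apply IH|].
    rewrite sum_Sn.
    replace (S m - S m)%nat with 0%nat by lia.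
    rewrite Rmult_minus_distr_l, Rmult_comm with (r2 := sum_n _ m).
    change plus with Rplus.
    rewrite <- (sum_n_mult_r (K := R_Ring) (/ a ^ 2)).
    rewrite Rplus_comm. unfold Rminus. f_equal.
    + replace (2 * S m)%nat with (S (S (2 * m))) by lia.
      unfold half_PI_sub_pow. rewrite Rminus_0_r.
      assert (E : (-1) ^ S m * (-1) ^ S m = 1).
      { rewrite <- pow_add. replace (S m + S m)%nat with (2 * S m)%nat by lia. apply pow_1_even. }
      rewrite E. simpl (2 * 0 + 2)%nat. field; split; auto. apply INR_fact_neq_0.
    + rewrite <- (Rmult_1_l (sum_n _ _)), Ropp_mult_distr_l.
      rewrite <- (sum_n_mult_l (K := R_Ring) (- (1))).
      apply sum_n_ext_loc. intros k Hk. change mult with Rmult.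
      replace (2 * (S m - k) + 2)%nat with (2 * (m - k) + 2 + 2)%nat by lia.
      rewrite (pow_add a (2 * (m - k) + 2) 2). change ((-1) ^ S m) with (-1 * (-1) ^ m).
      real_eq. field. repeat split; auto using pow_nonzero, INR_fact_neq_0.
Qed.

Lemma is_series_telescope : is_series (fun r => / (INR r + 1) - / (INR r + 2)) 1.
Proof.
  change (is_lim_seq (sum_n (fun r => / (INR r + 1) - / (INR r + 2))) 1).
  apply (is_lim_seq_ext (fun N => 1 - / (INR N + 2))).
  - intros N; induction N as [|N IH].
    + rewrite sum_O. simpl. field.
    + rewrite sum_Sn, <- IH. change plus with Rplus. rewrite S_INR.
      pose proof (pos_INR N). field; lra.
  - replace (Finite 1) with (Finite (1 - 0)) by (f_equal; ring).
    apply is_lim_seq_minus'; [apply is_lim_seq_const|].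
    change (Finite 0) with (Rbar_inv p_infty).
    apply is_lim_seq_inv; [|discriminate].
    eapply is_lim_seq_plus; [apply is_lim_seq_INR|apply is_lim_seq_const|].
    reflexivity.
Qed.

(** Convergence: [(2r+1)^2 >= (r+1) (r+2) / 2], and the series of
    [/ ((r+1) (r+2))] telescopes. *)
Lemma is_series_lambda (j : nat) :
  is_series (fun r => / (2 * INR r + 1) ^ (2 * j + 2)) (lambda (2 * INR j + 2)).
Proof.
  unfold lambda.
  rewrite (Series_ext _ (fun r => / (2 * INR r + 1) ^ (2 * j + 2))).
  - apply Series_correct.
    apply (@ex_series_le R_AbsRing R_CompleteNormedModule _
             (fun r => 2 * (/ (INR r + 1) - / (INR r + 2)))).
    + intros r. pose proof (pos_INR r). pose proof (odd_pos r).
      change norm with Rabs.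
      rewrite Rabs_pos_eq by (left; apply Rinv_0_lt_compat, pow_lt; lra).
      replace (2 * (/ (INR r + 1) - / (INR r + 2)))
        with (/ ((INR r + 1) * (INR r + 2) / 2)) by (field; lra).
      apply Rinv_le_contravar; [apply Rdiv_lt_0_compat; nra|].
      apply Rle_trans with ((2 * INR r + 1) ^ 2); [nra|].
      apply Rle_pow; [lra|lia].
    + exists (2 * 1). apply (is_series_scal 2 _ 1 is_series_telescope).
  - intros r. rewrite <- Rpower_pow by apply odd_pos.
    f_equal; f_equal. rewrite plus_INR, mult_INR. simpl. ring.
Qed.

Lemma is_series_sum_n (f : nat -> nat -> R) (l : nat -> R) (m : nat) :
  (forall k, (k <= m)%nat -> is_series (f k) (l k)) ->
  is_series (fun r => sum_n (fun k => f k r) m) (sum_n l m).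
Proof.
  induction m as [|m IH]; intros H.
  - rewrite sum_O. apply (is_series_ext (f 0%nat)); [|apply H; lia].
    intros; rewrite sum_O; reflexivity.
  - rewrite sum_Sn.
    apply (is_series_ext (fun r => plus (sum_n (fun k => f k r) m) (f (S m) r))).
    { intros; rewrite sum_Sn; reflexivity. }
    apply (is_series_plus (fun r => sum_n (fun k => f k r) m) (f (S m))); auto.
Qed.

(** The series of the integrals of
    [half_PI_sub_pow (2 m + 1) t * cos ((2 r + 1) t)] is summed in two ways: from the
    closed form of each integral, and as the limit of the integrals against the
    kernel. *)
Lemma lambda_recurrence (m : nat) :
  sum_n (fun k => (-1) ^ k * ((PI / 2) ^ (2 * k) / INR (fact (2 * k)))
                  * lambda (2 * INR m - 2 * INR k + 2)) m
  = (-1) ^ m * (PI / 4) * ((PI / 2) ^ (2 * m + 1) / INR (fact (2 * m + 1))).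
Proof.
  set (J := fun r => sum_n (fun k =>
    (-1) ^ m * (-1) ^ k * ((PI / 2) ^ (2 * k) / INR (fact (2 * k)))
      * / (2 * INR r + 1) ^ (2 * (m - k) + 2)) m).
  assert (S1 : is_series J (sum_n (fun k =>
    (-1) ^ m * (-1) ^ k * ((PI / 2) ^ (2 * k) / INR (fact (2 * k)))
      * lambda (2 * INR m - 2 * INR k + 2)) m)).
  { apply (is_series_sum_n (fun k r =>
      (-1) ^ m * (-1) ^ k * ((PI / 2) ^ (2 * k) / INR (fact (2 * k)))
      * / (2 * INR r + 1) ^ (2 * (m - k) + 2))).
    intros k Hk. rewrite <- Rmult_minus_distr_l, <- minus_INR by auto.
    apply (is_series_scal (V := R_NormedModule)), is_series_lambda. }
  assert (S2 : is_series J (PI / 4 * half_PI_sub_pow (2 * m + 1) 0)).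
  { change (is_lim_seq (sum_n J) (PI / 4 * half_PI_sub_pow (2 * m + 1) 0)).
    apply (is_lim_seq_ext
      (fun N => RInt (fun t => half_PI_sub_pow (2 * m + 1) t * odd_cos_sum N t) 0 (PI / 2))).
    - intros N. apply is_RInt_unique.
      apply (is_RInt_ext (fun t =>
        sum_n (fun r => half_PI_sub_pow (2 * m + 1) t * cos ((2 * INR r + 1) * t)) N)).
      { intros t _. apply (sum_n_mult_l (K := R_Ring)). }
      apply (is_RInt_sum_n (fun r t => half_PI_sub_pow (2 * m + 1) t * cos ((2 * INR r + 1) * t))).
      intros r. apply is_RInt_half_PI_sub_pow_odd_cos.
      + pose proof (odd_pos r); lra.
      + apply cos_odd_half_PI.
    - replace (2 * m + 1)%nat with (S (2 * m)) by lia.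
      apply (lim_RInt_mult_odd_cos_sum _ (fun t => - half_PI_sub_pow (2 * m) t)).
      + apply is_derive_half_PI_sub_pow.
      + intros t. apply (continuous_opp (half_PI_sub_pow (2 * m))), continuous_half_PI_sub_pow. }
  assert (E : PI / 4 * half_PI_sub_pow (2 * m + 1) 0 = (-1) ^ m *
    sum_n (fun k => (-1) ^ k * ((PI / 2) ^ (2 * k) / INR (fact (2 * k)))
                  * lambda (2 * INR m - 2 * INR k + 2)) m).
  { rewrite <- (is_series_unique _ _ S2), (is_series_unique _ _ S1).
    rewrite <- (sum_n_mult_l (K := R_Ring) ((-1) ^ m)).
    apply sum_n_ext; intros k. change mult with Rmult.
    rewrite !Rmult_assoc; reflexivity. }
  unfold half_PI_sub_pow in E. rewrite Rminus_0_r in E.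
  rewrite Rmult_assoc, E, <- Rmult_assoc, <- pow_add.
  replace (m + m)%nat with (2 * m)%nat by lia.
  rewrite pow_1_even, Rmult_1_l; reflexivity.
Qed.

(** * Polynomials with lambda coefficients *)

Definition even_lambda_poly (m : nat) (x : R) : R :=
  sum_n_m (fun k => (-1) ^ k * x ^ (2 * k) * (PI ^ (2 * k) / INR (fact (2 * k)))
                    * lambda (2 * INR m - 2 * INR k + 2)) 0 m.

Definition odd_lambda_poly (m : nat) (x : R) : R :=
  sum_n_m (fun k => (-1) ^ k * x ^ (2 * k - 1) * (PI ^ (2 * k) / INR (fact (2 * k - 1)))
                    * lambda (2 * INR m - 2 * INR k + 2)) 1 m.

Lemma is_derive_sum_n_m (f : nat -> R -> R) (d : nat -> R) (a b : nat) (x : R) :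
  (forall k, (a <= k <= b)%nat -> is_derive (f k) x (d k)) ->
  is_derive (fun y => sum_n_m (fun k => f k y) a b) x (sum_n_m d a b).
Proof.
  intros H. destruct (le_lt_dec a b) as [Hab|Hab].
  - induction b as [|b IH].
    + replace a with 0%nat in * by lia. rewrite sum_n_n.
      apply (is_derive_ext (f 0%nat)); [|apply H; lia].
      intros; rewrite sum_n_n; reflexivity.
    + destruct (Nat.eq_dec a (S b)) as [->|Hne].
      * rewrite sum_n_n.
        apply (is_derive_ext (f (S b))); [|apply H; lia].
        intros; rewrite sum_n_n; reflexivity.
      * rewrite sum_n_Sm by lia.
        apply (is_derive_ext (fun y => plus (sum_n_m (fun k => f k y) a b) (f (S b) y))).
        { intros; rewrite sum_n_Sm by lia; reflexivity. }
        apply (@is_derive_plus R_AbsRing R_NormedModule); [apply IH; [intros; apply H|]; lia|apply H; lia].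
  - rewrite sum_n_m_zero by auto.
    apply (is_derive_ext (fun _ => zero)).
    + intros; rewrite sum_n_m_zero by auto; reflexivity.
    + apply (@is_derive_const R_AbsRing R_NormedModule).
Qed.

Lemma is_derive_monomial (a b c : R) (q : nat) (x : R) :
  is_derive (fun x => a * x ^ q * b * c) x (a * (INR q * x ^ pred q) * b * c).
Proof. auto_derive; trivial. ring. Qed.

Lemma is_derive_even_lambda_poly (m : nat) (x : R) :
  is_derive (even_lambda_poly m) x (odd_lambda_poly m x).
Proof.
  unfold odd_lambda_poly.
  evar_last.
  - apply (is_derive_sum_n_m (fun k x => (-1) ^ k * x ^ (2 * k) * (PI ^ (2 * k) / INR (fact (2 * k)))
                    * lambda (2 * INR m - 2 * INR k + 2))
      (fun k => (-1) ^ k * (INR (2 * k) * x ^ pred (2 * k)) * (PI ^ (2 * k) / INR (fact (2 * k)))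
                    * lambda (2 * INR m - 2 * INR k + 2))).
    intros k _. apply is_derive_monomial.
  - rewrite sum_Sn_m by lia.
    change plus with Rplus. rewrite Rmult_0_l, Rmult_0_r, !Rmult_0_l, Rplus_0_l.
    apply sum_n_m_ext_loc. intros k Hk.
    assert (E : INR (fact (2 * k)) = INR (2 * k) * INR (fact (2 * k - 1))).
    { rewrite <- mult_INR. f_equal.
      replace (2 * k)%nat with (S (2 * k - 1)) at 1 2 by lia. apply fact_simpl. }
    replace (pred (2 * k)) with (2 * k - 1)%nat by lia.
    rewrite E.
    real_eq.
    field. split; [apply INR_fact_neq_0|apply not_0_INR; lia].
Qed.

Lemma is_derive_odd_lambda_poly (m : nat) (x : R) :
  is_derive (odd_lambda_poly (S m)) x (- PI ^ 2 * even_lambda_poly m x).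
Proof.
  unfold even_lambda_poly.
  evar_last.
  - apply (is_derive_sum_n_m (fun k x => (-1) ^ k * x ^ (2 * k - 1) * (PI ^ (2 * k) / INR (fact (2 * k - 1)))
                    * lambda (2 * INR (S m) - 2 * INR k + 2))
      (fun k => (-1) ^ k * (INR (2 * k - 1) * x ^ pred (2 * k - 1)) * (PI ^ (2 * k) / INR (fact (2 * k - 1)))
                    * lambda (2 * INR (S m) - 2 * INR k + 2))).
    intros k _. apply is_derive_monomial.
  - rewrite <- sum_n_m_S, <- (sum_n_m_mult_l (K := R_Ring)).
    apply sum_n_m_ext. intros k. change mult with Rmult.
    replace (2 * S k - 1)%nat with (S (2 * k)) by lia.
    replace (2 * S k)%nat with (2 * k + 2)%nat by lia.
    rewrite fact_simpl, mult_INR, !S_INR, pow_add, Nat.pred_succ.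
    replace (2 * (INR m + 1) - 2 * (INR k + 1) + 2) with (2 * INR m - 2 * INR k + 2) by ring.
    change ((-1) ^ S k) with (-1 * (-1) ^ k).
    real_eq.
    field. split; [apply INR_fact_neq_0|]. rewrite <- S_INR; apply not_0_INR; lia.
Qed.

Lemma even_lambda_poly_opp (m : nat) (x : R) :
  even_lambda_poly m (- x) = even_lambda_poly m x.
Proof.
  apply sum_n_m_ext. intros k. rewrite !pow_mult. do 3 f_equal. f_equal. ring.
Qed.

Lemma odd_lambda_poly_opp (m : nat) (x : R) :
  odd_lambda_poly m (- x) = - odd_lambda_poly m x.
Proof.
  replace (- odd_lambda_poly m x) with (-1 * odd_lambda_poly m x) by ring.
  unfold odd_lambda_poly.
  rewrite <- (sum_n_m_mult_l (K := R_Ring)). apply sum_n_m_ext_loc.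
  intros k Hk. change mult with Rmult.
  replace (2 * k - 1)%nat with (S (2 * (k - 1))) by lia.
  rewrite <- !tech_pow_Rmult, !pow_mult. replace ((- x) ^ 2) with (x ^ 2) by ring.
  real_eq. ring.
Qed.

Lemma eq_of_is_derive_eq (f g d : R -> R) (x0 : R) :
  (forall x, is_derive f x (d x)) -> (forall x, is_derive g x (d x)) ->
  f x0 = g x0 -> forall x, f x = g x.
Proof.
  intros Hf Hg H0 x.
  destruct (MVT_abs (fun x => f x - g x) (fun _ => 0) x0 x) as [c [E _]].
  - intros c _. apply is_derive_Reals. evar_last.
    + apply (@is_derive_minus R_AbsRing R_NormedModule); [apply Hf|apply Hg].
    + unfold minus, plus, opp; simpl; ring.
  - rewrite Rabs_R0, Rmult_0_l in E. apply Rabs_eq_0 in E. lra.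
Qed.

Lemma is_derive_add_shift (f d : R -> R) (x : R) :
  (forall x, is_derive f x (d x)) ->
  is_derive (fun x => f (x + 1) + f x) x (d (x + 1) + d x).
Proof.
  intros H. apply (@is_derive_plus R_AbsRing R_NormedModule (fun x => f (x + 1)) f); [|apply H].
  evar_last.
  - apply (is_derive_comp f (fun x => x + 1)); [apply H|auto_derive; trivial].
  - unfold scal; simpl; unfold mult; simpl; ring.
Qed.

Lemma is_derive_sub_shift_pow (p : nat) (c x : R) :
  is_derive (fun x => c / INR (fact (S p)) * ((x + 1) ^ S p - x ^ S p)) x
    (c / INR (fact p) * ((x + 1) ^ p - x ^ p)).
Proof.
  assert (G : forall q c, is_derive (fun x => c * ((x + 1) ^ q - x ^ q)) x
    (c * (INR q * ((x + 1) ^ pred q - x ^ pred q)))).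
  { clear c; intros q c. auto_derive; trivial. ring. }
  evar_last; [apply G|]. rewrite fact_simpl, mult_INR. simpl pred.
  real_eq.
  field. split; [apply INR_fact_neq_0|apply not_0_INR; lia].
Qed.

(** Induction along the chain [O_0, E_0, O_1, E_1, ...]: each equation has the
    preceding one as its derivative, up to a factor, and is checked at
    [x = -1/2]. *)
Lemma lambda_poly_shift (m : nat) :
  (forall x, odd_lambda_poly m (x + 1) + odd_lambda_poly m x
    = (-1) ^ m / 4 * PI ^ (2 * m + 2) / INR (fact (2 * m)) * ((x + 1) ^ (2 * m) - x ^ (2 * m)))
  /\
  (forall x, even_lambda_poly m (x + 1) + even_lambda_poly m x
    = (-1) ^ m / 4 * PI ^ (2 * m + 2) / INR (fact (2 * m + 1))
      * ((x + 1) ^ (2 * m + 1) - x ^ (2 * m + 1))).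
Proof.
  (* The step from [O_m] to [E_m]. *)
  assert (OE : forall m,
    (forall x, odd_lambda_poly m (x + 1) + odd_lambda_poly m x
      = (-1) ^ m / 4 * PI ^ (2 * m + 2) / INR (fact (2 * m)) * ((x + 1) ^ (2 * m) - x ^ (2 * m))) ->
    forall x, even_lambda_poly m (x + 1) + even_lambda_poly m x
      = (-1) ^ m / 4 * PI ^ (2 * m + 2) / INR (fact (2 * m + 1))
        * ((x + 1) ^ (2 * m + 1) - x ^ (2 * m + 1))).
  { clear m; intros m HO.
    replace (2 * m + 1)%nat with (S (2 * m)) by lia.
    apply (eq_of_is_derive_eq _ _ (fun x => odd_lambda_poly m (x + 1) + odd_lambda_poly m x) (- / 2)).
    - intros x; apply is_derive_add_shift, is_derive_even_lambda_poly.
    - intros x; rewrite HO; apply is_derive_sub_shift_pow.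
    - rewrite even_lambda_poly_opp.
      replace (- / 2 + 1) with (/ 2) by field.
      replace (even_lambda_poly m (/ 2)) with
        ((-1) ^ m * (PI / 4) * ((PI / 2) ^ (2 * m + 1) / INR (fact (2 * m + 1)))).
      2: { rewrite <- lambda_recurrence. apply sum_n_m_ext. intros k.
        unfold Rdiv. rewrite (Rpow_mult_distr PI).
        real_eq. ring. }
      replace (- / 2) with (-1 * / 2) by ring.
      rewrite Rpow_mult_distr, pow_1_odd. unfold Rdiv.
      replace (2 * m + 1)%nat with (S (2 * m)) by lia.
      replace (2 * m + 2)%nat with (S (S (2 * m))) by lia.
      rewrite Rpow_mult_distr. simpl (PI ^ S _). field. apply INR_fact_neq_0. }
  induction m as [|m [_ IH]].
  (* [O_0] is an empty sum and [(x + 1)^0 - x^0 = 0]. *)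
  - assert (O : forall x, odd_lambda_poly 0 (x + 1) + odd_lambda_poly 0 x
      = (-1) ^ 0 / 4 * PI ^ (2 * 0 + 2) / INR (fact (2 * 0)) * ((x + 1) ^ (2 * 0) - x ^ (2 * 0))).
    { intros x. unfold odd_lambda_poly. rewrite !sum_n_m_zero by lia.
      change zero with 0. simpl. field. }
    split; [apply O|apply (OE 0%nat O)].
  - enough (O : forall x, odd_lambda_poly (S m) (x + 1) + odd_lambda_poly (S m) x
      = (-1) ^ S m / 4 * PI ^ (2 * S m + 2) / INR (fact (2 * S m))
        * ((x + 1) ^ (2 * S m) - x ^ (2 * S m))).
    { split; [apply O|apply (OE (S m) O)]. }
    set (c := (-1) ^ S m / 4 * PI ^ (2 * S m + 2)).
    replace (2 * S m)%nat with (S (2 * m + 1)) by lia.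
    apply (eq_of_is_derive_eq _ _
      (fun x => - PI ^ 2 * even_lambda_poly m (x + 1) + - PI ^ 2 * even_lambda_poly m x) (- / 2)).
    + intros x. apply (is_derive_add_shift (odd_lambda_poly (S m))
        (fun x => - PI ^ 2 * even_lambda_poly m x)).
      apply is_derive_odd_lambda_poly.
    + intros x. rewrite <- Rmult_plus_distr_l, IH.
      evar_last; [apply is_derive_sub_shift_pow|].
      unfold c. replace (2 * S m + 2)%nat with (2 * m + 2 + 2)%nat by lia.
      rewrite (pow_add PI _ 2). change ((-1) ^ S m) with (-1 * (-1) ^ m).
      real_eq.
      field. apply INR_fact_neq_0.
    + rewrite odd_lambda_poly_opp. replace (- / 2 + 1) with (/ 2) by field.
      replace (S (2 * m + 1)) with (2 * S m)%nat by lia.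
      rewrite !pow_mult. replace ((- / 2) ^ 2) with ((/ 2) ^ 2) by field. ring.
Qed.

(** The functional equation says exactly that the left-hand side keeps the same
    value from [n] to [n + 1]; at [n = 1] it reads [- alpha - Q 1], which is
    [Q 0] by the functional equation at [0]. *)
Lemma alternating_power_sum (Q : R -> R) (alpha : R) (p n : nat) :
  (0 < p)%nat -> (0 < n)%nat ->
  (forall x, Q (x + 1) + Q x = - alpha * ((x + 1) ^ p - x ^ p)) ->
  alpha * (2 * sum_n_m (fun j : nat => (-1) ^ j * INR j ^ p) 1 (n - 1) + (-1) ^ n * INR n ^ p)
  + (-1) ^ n * Q (INR n) = Q 0.
Proof.
  intros Hp Hn HQ. destruct n as [|n]; [lia|]. clear Hn.
  replace (S n - 1)%nat with n by lia.
  induction n as [|n IH].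
  - rewrite sum_n_m_zero by lia. change zero with 0.
    specialize (HQ 0). rewrite Rplus_0_l, pow1, pow_ne_zero in HQ by lia.
    simpl. rewrite pow1. lra.
  - rewrite sum_n_Sm by lia. change plus with Rplus.
    rewrite <- IH. rewrite (S_INR (S n)).
    specialize (HQ (INR (S n))).
    change ((-1) ^ S (S n)) with (-1 * (-1) ^ S n).
    replace (Q (INR (S n) + 1))
      with (- alpha * ((INR (S n) + 1) ^ p - INR (S n) ^ p) - Q (INR (S n))) by lra.
    ring.
Qed.

Theorem corollary1p7 (n : nat) (hn : (0 < n)%nat) :
  (forall m : nat, (0 < m)%nat ->
     (-1) ^ (m + 1) / 4
       * (2 * sum_n_m (fun j : nat => (-1) ^ j * INR j ^ (2 * m)) 1 (n - 1)
          + (-1) ^ n * INR n ^ (2 * m))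
       * (PI ^ (2 * m + 2) / INR (fact (2 * m)))
     + (-1) ^ n
       * sum_n_m (fun k : nat =>
           (-1) ^ k * INR n ^ (2 * k - 1)
             * (PI ^ (2 * k) / INR (fact (2 * k - 1)))
             * lambda (2 * INR m - 2 * INR k + 2)) 1 m
     = 0)
  /\
  (forall m : nat,
     (-1) ^ (m + 1) / 4
       * (2 * sum_n_m (fun j : nat => (-1) ^ j * INR j ^ (2 * m + 1)) 1 (n - 1)
          + (-1) ^ n * INR n ^ (2 * m + 1))
       * (PI ^ (2 * m + 2) / INR (fact (2 * m + 1)))
     + sum_n_m (fun k : nat =>
         (-1) ^ k * ((-1) ^ n * INR n ^ (2 * k) - delta k)
           * (PI ^ (2 * k) / INR (fact (2 * k)))
           * lambda (2 * INR m - 2 * INR k + 2)) 0 m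
     = 0).
Proof.
  split.
  - intros m Hm. fold (odd_lambda_poly m (INR n)).
    (* An odd function vanishes at 0. *)
    assert (Q0 : odd_lambda_poly m 0 = 0).
    { pose proof (odd_lambda_poly_opp m 0) as H. rewrite Ropp_0 in H. lra. }
    rewrite <- Q0, <- (alternating_power_sum (odd_lambda_poly m)
      ((-1) ^ (m + 1) / 4 * (PI ^ (2 * m + 2) / INR (fact (2 * m)))) (2 * m) n);
      [ring|lia|auto|].
    intros x. rewrite (proj1 (lambda_poly_shift m) x), (pow_add _ m 1).
    field. apply INR_fact_neq_0.
  - intros m.
    replace (sum_n_m (fun k : nat =>
         (-1) ^ k * ((-1) ^ n * INR n ^ (2 * k) - delta k)
           * (PI ^ (2 * k) / INR (fact (2 * k)))
           * lambda (2 * INR m - 2 * INR k + 2)) 0 m)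
      with ((-1) ^ n * even_lambda_poly m (INR n) + -1 * even_lambda_poly m 0).
    + rewrite <- (alternating_power_sum (even_lambda_poly m)
      ((-1) ^ (m + 1) / 4 * (PI ^ (2 * m + 2) / INR (fact (2 * m + 1)))) (2 * m + 1) n);
        [ring|lia|auto|].
      intros x. rewrite (proj2 (lambda_poly_shift m) x), (pow_add _ m 1).
      field. apply INR_fact_neq_0.
    (* [delta k] is [0^(2k)], hence the second part of the sum is [E_m 0]. *)
    + unfold even_lambda_poly. rewrite <- !(sum_n_m_mult_l (K := R_Ring)).
      change Rplus with (@plus R_AbelianMonoid). rewrite <- sum_n_m_plus.
      apply sum_n_m_ext. intros k. change plus with Rplus. change mult with Rmult.
      replace (0 ^ (2 * k)) with (delta k).
      * real_eq. ring.
      * unfold delta. destruct k; [reflexivity|].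
        rewrite pow_ne_zero by lia. reflexivity.
Qed.
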